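(* Let $n\geq 1$ and let $X_1,\dots,X_n$ be topological spaces, each of which is both pseudocompact and functionally countable. Then the product $X_1\times\cdots\times X_n$ is also pseudocompact and functionally countable.
   Context: All spaces are assumed to be Hausdorff. A space $X$ is pseudocompact if it is Tychonoff and every continuous real-valued function defined on $X$ is bounded. A space $X$ is functionally countable if every continuous function $f\colon X\to\mathbb{R}$ has countable image. Products carry the product topology. *)

(* Defs.v *)
From mathcomp Require Import all_boot all_order all_algebra.
From mathcomp Require Import all_classical all_reals all_analysis.

Set Implicit Arguments.
Unset Strict Implicit.
Unset Printing Implicit Defensive.

Import Order.TTheory GRing.Theory Num.Theory.
Import numFieldNormedType.Exports.

Local Open Scope classical_set_scope.
Local Open Scope ring_scope.

(* [completely_regular_space] is phrased with [uniform_separator]; by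
   [uniform_separatorP] this is separation of points from closed sets by
   continuous functions into [0, 1]. It does not include Hausdorffness. *)
Definition tychonoff_space (T : topologicalType) : Prop :=
  hausdorff_space T /\ completely_regular_space T.

Definition pseudocompact (R : realType) (T : topologicalType) : Prop :=
  tychonoff_space T /\
  forall f : T -> R, continuous f -> [bounded f x | x in [set: T]].

Definition functionally_countable (R : realType) (T : topologicalType) : Prop :=
  forall f : T -> R, continuous f -> countable (range f).

(* Main.v *)
Require Import Defs.
From mathcomp Require Import all_boot all_order all_algebra.
From mathcomp Require Import all_classical all_reals all_analysis.
From mathcomp Require Import lra.

Set Implicit Arguments.
Unset Strict Implicit.
Unset Printing Implicit Defensive.

Import Order.TTheory GRing.Theory Num.Theory.
Import numFieldNormedType.Exports.

Local Open Scope classical_set_scope.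
Local Open Scope ring_scope.

(** A product of two pseudocompact spaces need not be pseudocompact; functional
countability is what repairs this, by making each factor sequentially feebly
compact: every sequence of nonempty open sets has a subsequence and a point
each of whose neighbourhoods meets almost all members of that subsequence.
This property, unlike pseudocompactness, passes to products by extracting
subsequences one factor after the other ([seq_feebly_compact_prod]), and it
makes continuous real functions bounded.

Two lemmas use functional countability. The first is that it extends to
countable families: if X is functionally countable, then x |-> (f_k x)_k has
countable image for any sequence of continuous f_k
([functionally_countable_family]). The images of the f_k being countable, all
the f_k can be cut at a dense set of missed values; the resulting countably
many clopen sets are recorded in one continuous function with values in the
ternary Cantor set.

The second is sequential feeble compactness
([functionally_countable_seq_feebly_compact]). A sequence of open sets without
a convergent subsequence can be split in two such sequences on which some
continuous function is respectively small and large. Iterating gives a binary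
tree, and a cluster point along each branch. Distinct branches have cluster
points separated by one of the countably many splitting functions, so these
functions jointly take uncountably many values, which the first lemma forbids.

For functional countability of the product, let f be continuous on X * Y, where
X is functionally countable and X * Y and Y are feebly compact. The sup-distance between the sections f(_, y) and
f(_, y') is continuous in y', hence totally bounded on Y, so a countable subset
of Y determines each section f(x, _). The first lemma then shows that there are
only countably many sections ([functionally_countable_sections]). On the
product of the X i this is applied to each X i against the whole product, with
the function that overwrites the i-th coordinate: the value of f depends on
each coordinate only through a natural number, and finitely many coordinates
can be exchanged one at a time.

The image of a map being countable is expressed throughout by a [code] in a
countable type whose equality forces equality of the values; this form
restricts, combines and pulls back without reference to images. *)

(** * Countable families of continuous functions *)

Lemma near_gt_continuous (R : realType) (X : topologicalType) (f : X -> R)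
    (a : R) (x : X) : continuous f -> a < f x -> \forall y \near x, a < f y.
Proof. by move=> fc afx; apply: cvgr_gt afx; exact: fc. Qed.

Lemma near_lt_continuous (R : realType) (X : topologicalType) (f : X -> R)
    (a : R) (x : X) : continuous f -> f x < a -> \forall y \near x, f y < a.
Proof. by move=> fc afx; apply: cvgr_lt afx; exact: fc. Qed.

Lemma open_gt_continuous (R : realType) (X : topologicalType) (f : X -> R)
    (a : R) : continuous f -> open [set x | a < f x].
Proof. by move=> fc; rewrite openE => x; exact: near_gt_continuous. Qed.

Lemma countable_avoid (R : realType) (A : set R) (a b : R) :
  countable A -> a < b -> exists2 t, a < t < b & ~ A t.
Proof.
move=> cA ab; apply: contrapT => noA.
have sub : `]a, b[%classic `<=` A.
  move=> t /=; rewrite in_itv /= => abt; apply: contrapT => nAt.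
  by apply: noA; exists t.
have /countable_lebesgue_measure0 := sub_countable (subset_card_le sub) cA.
rewrite lebesgue_measure_itv /= lte_fin ab -EFinB => -[] /eqP.
by rewrite subr_eq0 gt_eqF.
Qed.

(** The passage from images to codes, by an injection of the image in [nat]. *)
Lemma functionally_countable_code (R : realType) (X : topologicalType)
    (h : X -> R) : functionally_countable R X -> continuous h ->
  exists code : X -> nat, forall x x', code x = code x' -> h x = h x'.
Proof.
move=> fcX hc; have /countable_injP [g ginj] := fcX h hc.
exists (g \o h) => x x' /= gg; apply: ginj => //; apply: mem_set; by eexists.
Qed.

(** Partial sums of the point of the Cantor set with ternary digits [2 * c i x],
halved. *)
Definition ternary_partial (R : realType) (X : Type) (c : nat -> X -> bool)
    (n : nat) (x : X) : R :=
  \sum_(i < n) (c i x)%:R * 3%:R ^- i.+1.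

Lemma ternary_partialS (R : realType) (X : Type) (c : nat -> X -> bool) n x :
  ternary_partial R c n.+1 x =
  ternary_partial R c n x + (c n x)%:R * 3%:R ^- n.+1.
Proof. by rewrite /ternary_partial big_ord_recr. Qed.

Lemma ternary_partial_tail (R : realType) (X : Type) (c : nat -> X -> bool)
    n k x :
  ternary_partial R c n x <= ternary_partial R c (n + k) x <=
    ternary_partial R c n x + (3%:R ^- n - 3%:R ^- (n + k)) / 2%:R.
Proof.
elim: k => [|k]; first by rewrite addn0 subrr mul0r addr0 lexx.
rewrite addnS ternary_partialS.
have p3 : 0 < 3%:R ^- (n + k).+1 :> R by rewrite invr_gt0 exprn_gt0.
have -> : 3%:R ^- (n + k) = 3%:R * 3%:R ^- (n + k).+1 :> R.
  by rewrite exprS invfM mulrA divff ?mul1r// pnatr_eq0.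
by move: p3; case: (c _ _) => /=; lra.
Qed.

(** The partial sums increase, so their supremum is the sum of the series; base
3 rather than 2 keeps the tail after [n] digits at half of the weight of the
last digit, so that the sum determines the digits. *)
Lemma ternary_sum (R : realType) (X : Type) (c : nat -> X -> bool) :
  exists h : X -> R, forall n x,
  ternary_partial R c n x <= h x <= ternary_partial R c n x + 3%:R ^- n / 2%:R.
Proof.
exists (fun x => sup (range (ternary_partial R c ^~ x))) => n x.
have p3 m : 0 < 3%:R ^- m :> R by rewrite invr_gt0 exprn_gt0.
have ub : ubound (range (ternary_partial R c ^~ x))
    (ternary_partial R c n x + 3%:R ^- n / 2%:R).
  move=> _ [m _ <-]; have [mn|/ltnW nm] := leqP m n.
    have := ternary_partial_tail R c m (n - m) x; rewrite subnKC//.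
    by have := p3 n; lra.
  have := ternary_partial_tail R c n (m - n) x; rewrite subnKC//.
  by have := p3 m; lra.
apply/andP; split; last by apply: ge_sup => //; exists (ternary_partial R c 0 x), 0%N.
by apply: ub_le_sup; [eexists; exact: ub|exists n].
Qed.

(** The ternary sum of the indicators is continuous, since each partial sum is
locally constant and the tails are uniformly small, and it determines every
indicator; its countable image thus encodes them all. *)
Lemma functionally_countable_clopen (R : realType) (X : topologicalType)
    (c : nat -> X -> bool) : functionally_countable R X ->
  (forall i x, \forall y \near x, c i y = c i x) ->
  exists code : X -> nat,
    forall x x', code x = code x' -> forall i, c i x = c i x'.
Proof.
move=> fcX cc; have [h hP] := ternary_sum R c.
have p3 m : 0 < 3%:R ^- m :> R by rewrite invr_gt0 exprn_gt0.
have hc : continuous h.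
  move=> x; apply/cvgrPdist_lt => e e0.
  have [n ne] : exists n, 3%:R ^- n < e.
    have /cvgrPdist_lt/(_ _ e0) : geometric 1 3%:R^-1 n @[n --> \oo] --> (0 : R).
      by apply: cvg_geometric; rewrite ger0_norm ?invr_ge0// invf_lt1// ltr1n.
    case=> n _ /(_ n (leqnn n)) /=; rewrite sub0r normrN mul1r exprVn => H.
    by exists n; apply: le_lt_trans (ler_norm _) H.
  have : \forall y \near x, ternary_partial R c n y = ternary_partial R c n x.
    elim: n {ne} => [|n IHn].
      by apply: nearW => y; rewrite /ternary_partial !big_ord0.
    have Hc := cc n x; apply: filterS2 IHn Hc => y Sy cy.
    by rewrite !ternary_partialS Sy cy.
  apply: filterS => y Sy; have := hP n x; have := hP n y; rewrite Sy => h1 h2.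
  have := p3 n; move: h1 h2 ne => /andP[? ?] /andP[? ?] ? ?.
  by rewrite ltr_norml; lra.
have [code codeP] := functionally_countable_code fcX hc.
exists code => x x' /codeP hxx'.
(* The first differing digit separates the sums: it contributes 3^-(n+1),
   and all later digits together at most half of that. *)
have sep n y z : ternary_partial R c n y = ternary_partial R c n z ->
    c n y -> ~~ c n z -> h y <> h z.
  move=> Syz cy /negbTE cz; have /andP[+ _] := hP n.+1 y.
  have /andP[_] := hP n.+1 z; rewrite !ternary_partialS cy cz Syz /= mul1r mul0r.
  by have := p3 n.+1; lra.
have S n : ternary_partial R c n x = ternary_partial R c n x' -> c n x = c n x'.
  move=> Sn; case cx: (c n x); case cx': (c n x') => //.
    by have := sep n x x' Sn cx (negbT cx') hxx'.
  by have := sep n x' x (esym Sn) cx' (negbT cx) (esym hxx').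
have Seq n : ternary_partial R c n x = ternary_partial R c n x'.
  elim: n => [|n IHn]; first by rewrite /ternary_partial !big_ord0.
  by rewrite !ternary_partialS IHn (S n IHn).
by move=> i; apply: S.
Qed.

(** Each [f i] omits a dense set of values, and cutting [f i] at an omitted value
gives a clopen set. Cuts between any two rationals suffice to recover the
values of all the [f i]. *)
Lemma functionally_countable_family (R : realType) (X : topologicalType)
    (I : countType) (f : I -> X -> R) : functionally_countable R X ->
  (forall i, continuous (f i)) ->
  exists code : X -> nat,
    forall x x', code x = code x' -> forall i, f i x = f i x'.
Proof.
move=> fcX fc.
(* Even when the two rationals are in the wrong order the cut has to avoid
   the image of f i, for the indicator to be locally constant. *)
have /choice [t tP] : forall p : I * (rat * rat), exists t : R,
    (forall x, f p.1 x <> t) /\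
    ((p.2.1 < p.2.2)%R -> ratr p.2.1 < t < ratr p.2.2).
  move=> [i [q q']] /=; have [qq'|_] := ltP q q'.
    have [|t qt nt] := @countable_avoid R _ (ratr q) (ratr q') (fcX _ (fc i)).
      by rewrite ltr_rat.
    by exists t; split => // x fx; apply: nt; exists x.
  have [t _ nt] := @countable_avoid R _ _ _ (fcX _ (fc i)) (@ltr01 R).
  by exists t; split => // x fx; apply: nt; exists x.
pose c n x := if unpickle n is Some p then t p < f p.1 x else false.
have [|code codeP] := @functionally_countable_clopen R X c fcX.
  move=> n x; rewrite /c; case: (unpickle n) => [p|] /=; last exact: nearW.
  have [/(_ x) fxt _] := tP p.
  have [ltx|lex] := ltP (t p) (f p.1 x).
    by apply: filterS (near_gt_continuous (fc p.1) ltx) => y ->.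
  have {lex}ltx : f p.1 x < t p by rewrite lt_neqAle lex andbT; apply/eqP.
  apply: filterS (near_lt_continuous (fc p.1) ltx) => y /ltW.
  by rewrite leNgt => /negbTE.
exists code => x x' /codeP cxx'.
have sep i y z : (forall n, c n y = c n z) -> ~ f i y < f i z.
  move=> cyz /rat_in_itvoo [q]; rewrite in_itv/= => /andP[yq].
  move=> /rat_in_itvoo [q']; rewrite in_itv/= => /andP[qq' q'z].
  have := cyz (pickle (i, (q, q'))); rewrite /c pickleK.
  have [_ /=] := tP (i, (q, q')); rewrite ltr_rat in qq' => /(_ qq') /andP[h1 h2].
  have -> : t (i, (q, q')) < f i z by apply: lt_trans q'z.
  by rewrite ltNge (ltW (lt_trans yq h1)).
move=> i; have [h|h|//] := ltgtP (f i x) (f i x').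
  by have := sep i _ _ cxx' h.
by have := sep i x' x (fun n => esym (cxx' n)) h.
Qed.

(** * Feeble compactness and sequential feeble compactness *)

(** For Tychonoff spaces this is equivalent to pseudocompactness; being about
open sets, it is the form in which pseudocompactness is used. *)
Definition feebly_compact (T : topologicalType) : Prop :=
  forall U : nat -> set T, (forall n, open (U n)) -> (forall n, U n !=set0) ->
  exists x : T, forall V, nbhs x V ->
    forall N, exists2 n, (N <= n)%N & V `&` U n !=set0.

Definition eventually_meets (T : topologicalType) (U : nat -> set T) (x : T) :=
  forall V, nbhs x V -> exists N, forall n, (N <= n)%N -> V `&` U n !=set0.

Definition seq_feebly_compact (T : topologicalType) : Prop :=
  forall U : nat -> set T, (forall n, open (U n)) -> (forall n, U n !=set0) ->
  exists2 phi : nat -> nat, {homo phi : m n / (m < n)%N} &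
    exists x, eventually_meets (U \o phi) x.

Lemma homo_ltn_ge (phi : nat -> nat) :
  {homo phi : m n / (m < n)%N} -> forall n, (n <= phi n)%N.
Proof.
move=> hphi; elim=> // n IHn; exact: leq_ltn_trans IHn (hphi _ _ (ltnSn n)).
Qed.

Lemma seq_feebly_compactW (T : topologicalType) :
  seq_feebly_compact T -> feebly_compact T.
Proof.
move=> sT U oU U0; have [phi hphi [x xP]] := sT U oU U0.
exists x => V /xP [M MP] N; exists (phi (maxn M N)); last exact: MP (leq_maxl _ _).
exact: leq_trans (leq_maxr _ _) (homo_ltn_ge hphi _).
Qed.

(** A cluster point of the open sets [n < `|f|] would be a point where f is
locally unbounded. *)
Lemma feebly_compact_bounded (R : realType) (T : topologicalType) (f : T -> R) :
  feebly_compact T -> continuous f -> [bounded f x | x in [set: T]].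
Proof.
move=> fT fc.
have nfc : continuous (fun x => `|f x|).
  by move=> x; apply: cvg_norm; exact: fc.
suff [n nP] : exists n : nat, forall x, `|f x| <= n%:R.
  exists n%:R; split; first exact: num_real.
  by move=> M nM x _ /=; apply: le_trans (nP x) (ltW nM).
apply: contrapT => nob.
have [|n|x xP] := fT (fun n => [set x | n%:R < `|f x|]).
- by move=> n; exact: open_gt_continuous.
- apply: contrapT => h; apply: nob; exists n => x; rewrite leNgt.
  by apply/negP => nx; apply: h; exists x.
have xx1 : `|f x| < `|f x| + 1 by rewrite ltrDl.
have [n nn [y [/= yx yn]]] := xP _ (near_lt_continuous nfc xx1)
  (Num.trunc (`|f x| + 1)).+1.
have : `|f x| + 1 < n%:R.
  apply: lt_le_trans (truncnS_gt _) _; by rewrite ler_nat.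
by rewrite ltNge (ltW (lt_trans yn yx)).
Qed.

Lemma big_ord_vanishing_tail (V : nmodType) (a : nat -> V) (m n : nat) :
  (forall i, (m <= i)%N -> a i = 0) -> (forall i, (n <= i)%N -> a i = 0) ->
  \sum_(i < m) a i = \sum_(i < n) a i.
Proof.
wlog mn : m n / (m <= n)%N.
  by move=> H; have [/H //|/ltnW /H e ? ?] := leqP m n; rewrite e.
move=> am _; rewrite -!(big_mkord xpredT a) [RHS](big_cat_nat (n := m)) //=.
rewrite [X in _ = _ + X]big_nat_cond [X in _ = _ + X]big1 ?addr0// => i.
by case/andP => /andP[/am].
Qed.

Lemma completely_regular_bump (R : realType) (T : topologicalType) (x : T)
    (U : set T) : completely_regular_space T -> open U -> U x ->
  exists f : T -> R, [/\ continuous f, forall y, 0 <= f y, f x = 1 &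
    forall y, ~ U y -> f y = 0].
Proof.
move=> crT oU Ux; have [||f [fc f01 fx fU]] :=
  (uniform_separatorP (R := R) [set x] (~` U)).1 (crT x (~` U) _ _).
- exact: open_closedC.
- by apply.
exists (fun y => 1 - f y); split.
- by move=> y; apply: cvgB; [exact: cvg_cst|exact: fc].
- move=> y; have /f01 : range f (f y) by exists y.
  by rewrite /= in_itv/= subr_ge0 => /andP[].
- by rewrite [f x]fx ?subr0//; exists x.
- by move=> y Uy; rewrite [f y]fU ?subrr//; exists y.
Qed.

(** A sequence of nonempty open sets without cluster point is locally finite, so
the sum of [n] times a bump function in the [n]-th set is continuous; it is
unbounded. *)
Lemma pseudocompact_feebly_compact (R : realType) (T : topologicalType) :
  pseudocompact R T -> feebly_compact T.
Proof.
move=> [[_ crT] bT] U oU U0; apply: contrapT => noc.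
have /choice [N NP] : forall x : T, exists N : nat,
    \forall y \near x, forall n, (N <= n)%N -> ~ U n y.
  move=> x; apply: contrapT => noN; apply: noc; exists x => V xV N.
  apply: contrapT => noV; apply: noN; exists N; apply: filterS xV => y Vy n Nn Uy.
  by apply: noV; exists n => //; exists y.
have /choice [p pU] : forall n, exists x, U n x by move=> n; exact: U0.
have /choice [g gP] : forall n, exists f : T -> R, [/\ continuous f,
    forall y, 0 <= f y, f (p n) = 1 & forall y, ~ U n y -> f y = 0].
  by move=> n; exact: completely_regular_bump.
pose S M y := \sum_(i < M) i%:R * g i y.
pose F y := S (N y) y.
(* N is not continuous, but truncating beyond any valid bound gives the same
   sum, so near x the function F is a fixed finite sum. *)
have FE M y : (forall n, (M <= n)%N -> ~ U n y) -> F y = S M y.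
  move=> MU; apply: (@big_ord_vanishing_tail _ (fun i => i%:R * g i y)) => i.
    by move=> /(nbhs_singleton (NP y)); have [_ _ _ gU] := gP i => /gU ->; rewrite mulr0.
  by move=> /MU; have [_ _ _ gU] := gP i => /gU ->; rewrite mulr0.
have Fc : continuous F.
  move=> x; have Sc : continuous (S (N x)).
    have S0 : S 0%N = fun=> 0 by apply/funext => y; rewrite /S big_ord0.
    have SS M : S M.+1 = fun y => S M y + M%:R * g M y.
      by apply/funext => y; rewrite /S big_ord_recr.
    elim: (N x) => [|M IHM] y; first by rewrite S0; exact: cvg_cst.
    rewrite SS; apply: cvgD; first exact: IHM.
    by apply: cvgM; [exact: cvg_cst|have [gc _ _ _] := gP M; exact: gc].
  apply/cvgrPdist_lt => e e0; have /cvgrPdist_lt/(_ _ e0) := Sc x.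
  apply: filterS2 (NP x) => y yP; rewrite (FE _ _ yP) (FE (N x)) //.
  exact: nbhs_singleton (NP x).
have [M [_ /(_ (`|M| + 1))]] := bT F Fc.
rewrite (le_lt_trans (ler_norm M)) ?ltrDl// => /(_ isT) MF.
pose n := (Num.trunc (`|M| + 1)).+1.
have nF : n%:R <= F (p n).
  have nN : (n < N (p n))%N.
    rewrite ltnNge; apply/negP => /(nbhs_singleton (NP (p n))); apply.
    exact: pU.
  rewrite /F /S (bigD1 (Ordinal nN)) //=; have [_ _ -> _] := gP n.
  rewrite mulr1 lerDl sumr_ge0 // => i _; rewrite mulr_ge0//.
  by have [_ + _ _] := gP i; apply.
have := MF (p n) I; rewrite /= leNgt => /negP; apply.
apply: lt_le_trans (truncnS_gt _) _; apply: le_trans nF (ler_norm _).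
Qed.

Lemma infinitely_often_subseq (Q : nat -> Prop) :
  (forall N, exists2 n, (N <= n)%N & Q n) ->
  exists2 phi : nat -> nat, {homo phi : m n / (m < n)%N} & forall m, Q (phi m).
Proof.
move=> QP; have /choice [g gP] : forall N, exists n, (N <= n)%N /\ Q n.
  by move=> N; have [n ? ?] := QP N; exists n.
pose phi := fix phi m := if m is k.+1 then g (phi k).+1 else g 0%N.
exists phi; last by case=> [|m]; apply: (gP _).2.
apply: (homo_ltn ltn_trans) => m.
by have [+ _] := gP (phi m).+1.
Qed.

Definition without_convergent_subseq (T : topologicalType) (U : nat -> set T) :=
  [/\ forall n, open (U n), forall n, U n !=set0 &
    forall phi : nat -> nat, {homo phi : m n / (m < n)%N} ->
      forall x, ~ eventually_meets (U \o phi) x].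

Lemma without_convergent_subseq_sub (T : topologicalType) (U V : nat -> set T)
    (phi : nat -> nat) : {homo phi : m n / (m < n)%N} ->
  (forall n, V n `<=` U (phi n)) ->
  (forall n, open (V n)) -> (forall n, V n !=set0) ->
  without_convergent_subseq U -> without_convergent_subseq V.
Proof.
move=> hphi VU oV V0 [oU U0 nU]; split=> // psi hpsi x Vx.
apply: (nU (phi \o psi) _ x) => [m n mn|W /Vx [N NP]].
  exact/hphi/hpsi.
exists N => n /NP [y [Wy Vy]]; exists y; split => //; exact: VU.
Qed.

(** A cluster point x of U is not a limit of U, so some neighbourhood W of x misses
infinitely many [U n], and on these a bump function at x supported in W is 0.
The neighbourhood of x where the bump function exceeds 2/3 also meets infinitely
many [U n], and its traces on them form the other half of the splitting. *)
Lemma without_convergent_subseq_split (R : realType) (T : topologicalType)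
    (U : nat -> set T) : completely_regular_space T -> feebly_compact T ->
  without_convergent_subseq U ->
  exists (V : bool -> nat -> set T) (f : T -> R), [/\ continuous f,
    forall b, without_convergent_subseq (V b),
    forall b n, exists m, V b n `<=` U m,
    forall n, V false n `<=` [set x | f x < 1 / 3%:R] &
    forall n, V true n `<=` [set x | 2%:R / 3%:R < f x]].
Proof.
move=> crT fT ncU; have [oU U0 nU] := ncU.
have [x xU] := fT U oU U0.
have [W [oW Wx oftW]] : exists W, [/\ open W, W x &
    forall N, exists2 n, (N <= n)%N & ~ (W `&` U n !=set0)].
  apply: contrapT => noW; apply: (nU id (fun _ _ => id) x) => V.
  rewrite nbhsE => -[W [oW Wx] WV]; apply: contrapT => noN; apply: noW.
  exists W; split => // N; apply: contrapT => noN'; apply: noN; exists N => n Nn.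
  apply: contrapT => VU; apply: noN'; exists n => // -[y [Wy Uy]].
  by apply: VU; exists y; split => //; exact: WV.
have [f [fc f0 fx fW]] := completely_regular_bump R crT oW Wx.
have xV : nbhs x [set y | 2%:R / 3%:R < f y].
  by apply: near_gt_continuous => //; rewrite fx; lra.
have [phi hphi phiV] := infinitely_often_subseq (xU _ xV).
have [psi hpsi psiW] := infinitely_often_subseq oftW.
exists (fun b n => if b then [set y | 2%:R / 3%:R < f y] `&` U (phi n) else U (psi n)), f.
split=> //.
- case; last by apply: (without_convergent_subseq_sub hpsi) ncU => n;
    [exact: subset_refl|exact: oU|exact: U0].
  apply: (without_convergent_subseq_sub hphi) ncU => [n|n|n] //.
  by apply: openI => //; exact: open_gt_continuous.
- by case=> n; [exists (phi n); exact: subIsetr|exists (psi n)].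
- move=> n y /= Uy; rewrite fW; first by lra.
  by move=> Wy; apply: (psiW n); exists y.
Qed.

(** The diagonal sequence D is false at n as soon as some sequence coded by n is
true there; so D is false at its own code, and a witness for that differs from
D while having the same code. *)
Lemma cantor_not_injective (e : (nat -> bool) -> nat) :
  exists b b' : nat -> bool, b <> b' /\ e b = e b'.
Proof.
pose D n := `[< forall b : nat -> bool, e b = n -> ~~ b n >].
have nD : ~ D (e D) by move=> /[dup] /asboolP/(_ D erefl)/negP.
have : ~ forall b : nat -> bool, e b = e D -> ~~ b (e D) by move/asboolP.
move=> /existsNP [b] /not_implyP [ebD /negP]; rewrite negbK => bD.
by exists b, D; split => // bE; apply: nD; rewrite -[X in X (e D)]bE.
Qed.

(** The nodes of a branch are listed from the deepest choice to the root, which is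
the order in which [foldr] grows the tree. *)
Fixpoint branch (b : nat -> bool) (k : nat) : seq bool :=
  if k is j.+1 then b j :: branch b j else [::].

(** A counterexample would generate a binary tree of splittings, and the cluster
points of its branches would take uncountably many values on the countable
family of splitting functions. *)
Lemma functionally_countable_seq_feebly_compact (R : realType)
    (T : topologicalType) : completely_regular_space T -> feebly_compact T ->
  functionally_countable R T -> seq_feebly_compact T.
Proof.
move=> crT fT fcT U0 oU0 U00; apply: contrapT => nc.
have ncU0 : without_convergent_subseq U0.
  by split=> // phi hphi x Ux; apply: nc; exists phi => //; exists x.
have /choice [g gP] : forall U, exists p : (bool -> nat -> set T) * (T -> R),
    without_convergent_subseq U -> [/\ continuous p.2,
    forall b, without_convergent_subseq (p.1 b),
    forall b n, exists m, p.1 b n `<=` U m,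
    forall n, p.1 false n `<=` [set x | p.2 x < 1 / 3%:R] &
    forall n, p.1 true n `<=` [set x | 2%:R / 3%:R < p.2 x]].
  move=> U; have [ncU|?] := pselect (without_convergent_subseq U).
    have [V [f ?]] := without_convergent_subseq_split R crT fT ncU.
    by exists (V, f).
  by exists (fun _ _ => setT, fun=> 0).
pose tree (s : seq bool) := foldr (fun b U => (g U).1 b) U0 s.
have treeP s : without_convergent_subseq (tree s).
  by elim: s => //= b s /gP [].
pose f s := (g (tree s)).2.
have fc s : continuous (f s) by have [] := gP _ (treeP s).
have [code codeP] := functionally_countable_family fcT fc.
have side b k j n : (k < j)%N -> tree (branch b j) n `<=`
    (if b k then [set x | 2%:R / 3%:R < f (branch b k) x]
     else [set x | f (branch b k) x < 1 / 3%:R]).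
  elim: j n => // j IHj n; rewrite ltnS leq_eqVlt => /predU1P[->|kj].
    have [_ _ _ + +] := gP _ (treeP (branch b j)).
    by rewrite /=; case: (b j) => f0 f1; [exact: f1|exact: f0].
  have [_ _ /(_ (b j) n) [m nm] _ _] := gP _ (treeP (branch b j)).
  by apply: subset_trans (IHj m kj).
(* A cluster point of the diagonal sequence of the branch b lies on the
   b-side of every splitting function along b, by continuity. *)
have /choice [x xP] : forall b, exists x, forall k,
    if b k then 2%:R / 3%:R <= f (branch b k) x else f (branch b k) x <= 1 / 3%:R.
  move=> b; have [||x xP] := fT (fun j => tree (branch b j) 0%N).
  - by move=> j; have [] := treeP (branch b j).
  - by move=> j; have [] := treeP (branch b j).
  exists x => k; have := side b k; case: (b k) => sk; rewrite leNgt; apply/negP => fx.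
  - have [j kj [y [/= yx /(sk _ _ kj)/= ]]] :=
      xP _ (near_lt_continuous (fc (branch b k)) fx) k.+1.
    by rewrite ltNge (ltW yx).
  - have [j kj [y [/= yx /(sk _ _ kj)/= ]]] :=
      xP _ (near_gt_continuous (fc (branch b k)) fx) k.+1.
    by rewrite ltNge (ltW yx).
have [b [b' [nbb' /codeP fbb']]] := cantor_not_injective (code \o x).
(* Where two branches first part they share the splitting function, whose
   values on the two sides differ. *)
have bb' k : branch b k = branch b' k -> b k = b' k.
  move=> bE; have := xP b k; have := xP b' k.
  by rewrite bE fbb'; case: (b k); case: (b' k) => //; lra.
have branchE k : branch b k = branch b' k.
  by elim: k => //= k IHk; rewrite IHk (bb' k IHk).
by apply: nbb'; apply/funext => k; exact: bb'.
Qed.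

(** * Products *)

(** Boxes inside the given open sets reduce the problem to the factors: a
subsequence good for the first factor is refined for the second, and stays
good for the first. *)
Lemma seq_feebly_compactX (X Y : topologicalType) :
  seq_feebly_compact X -> seq_feebly_compact Y ->
  seq_feebly_compact (X * Y)%type.
Proof.
move=> sX sY U oU U0.
have /choice [B BP] : forall n, exists B : set X * set Y,
    [/\ open B.1, open B.2, B.1 !=set0, B.2 !=set0 & B.1 `*` B.2 `<=` U n].
  move=> n; have [[x y] Uxy] := U0 n.
  have [[P Q] /= [xP yQ] PQU] : nbhs (x, y) (U n).
    by apply: open_nbhs_nbhs; split => //; exact: oU.
  exists (P°, Q°); split => /=; try exact: open_interior.
  - by exists x.
  - by exists y.
  - by move=> [u v] [/= /interior_subset Pu /interior_subset Qv]; apply: PQU.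
have [||phi hphi [x xP]] := sX (fun n => (B n).1).
- by move=> n; have [] := BP n.
- by move=> n; have [] := BP n.
have [||psi hpsi [y yQ]] := sY (fun n => (B (phi n)).2).
- by move=> n; have [] := BP (phi n).
- by move=> n; have [] := BP (phi n).
exists (phi \o psi) => [m n mn|]; first exact/hphi/hpsi.
exists (x, y) => W [[P Q] /= [/xP [M MP] /yQ [N NQ]] PQW].
exists (maxn M N) => n; rewrite geq_max => /andP[Mn Nn].
have [|u [Pu Bu]] := MP (psi n).
  exact: leq_trans Mn (homo_ltn_ge hpsi n).
have [v [Qv Bv]] := NQ n Nn.
have [_ _ _ _ BU] := BP (phi (psi n)).
by exists (u, v); split; [exact: PQW|exact: BU].
Qed.

(** The open boxes around p generate a filter finer than every coordinate filter,
hence finer than the neighbourhoods of p. For infinite I the boxes need not be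
neighbourhoods themselves. *)
Lemma prod_topology_box (I : eqType) (X : I -> topologicalType)
    (p : prod_topology X) (U : set (prod_topology X)) : nbhs p U ->
  exists V : forall i, set (X i), [/\ forall i, open (V i),
    forall i, V i (p i) & [set q | forall i, V i (q i)] `<=` U].
Proof.
move: U.
pose D := [set V : forall i, set (X i) | forall i, open (V i) /\ V i (p i)].
pose F := filter_from D (fun V => [set q : prod_topology X | forall i, V i (q i)]).
have FF : Filter F.
  apply: filter_from_filter.
    by exists (fun=> setT) => i; split => //; exact: openT.
  move=> V W DV DW; exists (fun i => V i `&` W i).
    by move=> i; have [? ?] := DV i; have [? ?] := DW i; split => //; exact: openI.
  by move=> q qVW; split => i; have [] := qVW i.
have Fp : F --> p.
  apply/cvg_sup => i W [_ [[N oN <-] /= Np] NW].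
  exists (dfwith (fun=> setT) i N) => [j|q qN].
    by case: dfwithP => // ? _; split => //; exact: openT.
  by apply: NW => /=; have := qN i; rewrite dfwithin.
by move=> U /Fp [V DV VU]; exists V; split => // i; have [] := DV i.
Qed.

Lemma continuous_prod_topology (I : finType) (X : I -> topologicalType)
    (T : topologicalType) (h : T -> prod_topology X) :
  (forall i, continuous (fun t => h t i)) -> continuous h.
Proof.
move=> hc t U /prod_topology_box [V [oV Vht VU]].
have : \forall s \near t, forall i, V i (h s i).
  apply: filter_forall => i; apply: hc; apply: open_nbhs_nbhs; split => //.
by apply: filterS => s Vs; apply: VU.
Qed.

Lemma seq_feebly_compact_prod (I : finType) (X : I -> topologicalType) :
  (forall i, seq_feebly_compact (X i)) -> seq_feebly_compact (prod_topology X).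
Proof.
move=> sX U oU U0.
have /choice [B BP] : forall n, exists B : forall i, set (X i),
    [/\ forall i, open (B i), forall i, B i !=set0 &
    [set q | forall i, B i (q i)] `<=` U n].
  move=> n; have [p Up] := U0 n.
  have [|B [oB Bp BU]] := @prod_topology_box _ _ p (U n).
    by apply: open_nbhs_nbhs; split => //; exact: oU.
  by exists B; split => // i; exists (p i).
have [phi hphi phiP] : exists2 phi : nat -> nat,
    {homo phi : m n / (m < n)%N} & forall i, i \in enum I ->
    exists x : X i, eventually_meets (fun n => B (phi n) i) x.
  elim: (enum I) => [|i s [phi hphi phiP]]; first by exists id.
  have [||psi hpsi [x xP]] := sX i (fun n => B (phi n) i).
  - by move=> n; have [] := BP (phi n).
  - by move=> n; have [] := BP (phi n).
  exists (phi \o psi) => [m n mn|j]; first exact/hphi/hpsi.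
  rewrite inE => /predU1P[->|/phiP [y yP]]; first by exists x.
  exists y => V /yP [N NP]; exists N => n Nn; apply: NP.
  exact: leq_trans Nn (homo_ltn_ge hpsi n).
exists phi => //.
pose x i : X i := sval (cid (phiP i (mem_enum _ i))).
have xP i : eventually_meets (fun n => B (phi n) i) (x i).
  exact: svalP (cid (phiP i (mem_enum _ i))).
exists x => W /prod_topology_box [V [oV Vx VW]].
have /choice [N NP] : forall i, exists N, forall n, (N <= n)%N ->
    V i `&` B (phi n) i !=set0.
  by move=> i; apply: xP; apply: open_nbhs_nbhs.
exists (\max_i N i)%N => n Nn.
have NPn i : V i `&` B (phi n) i !=set0.
  by apply: NP; apply: leq_trans Nn; exact: leq_bigmax.
pose q i := sval (cid (NPn i)).
have [_ _ BU] := BP (phi n); exists q; split.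
  by apply: VW => i; have [] := svalP (cid (NPn i)).
by apply: BU => i; have [] := svalP (cid (NPn i)).
Qed.

(** Complete regularity is uniformizability, and a product of uniform spaces is
uniform. *)
Lemma completely_regular_prod (R : realType) (I : eqType)
    (X : I -> topologicalType) :
  (forall i, completely_regular_space (X i)) ->
  completely_regular_space (prod_topology X).
Proof.
move=> crX; pose X' i := @completely_regular_uniformity.type R _ (crX i).
exact: (@uniform_completely_regular R (prod_topology X')).
Qed.

Lemma tychonoff_prod (R : realType) (I : eqType) (X : I -> topologicalType) :
  (forall i, tychonoff_space (X i)) -> tychonoff_space (prod_topology X).
Proof.
move=> tX; split; first by apply: hausdorff_product => i; have [] := tX i.
by apply: completely_regular_prod => // i; have [] := tX i.
Qed.

(** * Functional countability of products *)

(** This is continuity at y of the sup-distance between sections. If it fails, one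
picks recursively boxes [U n `*` V n] and decreasing neighbourhoods [W n] of y,
with [V n] inside [W n], such that over any point of [U n] the values of f on
[V n] and on [W n.+1] are more than e apart. Near a cluster point of the boxes,
where f oscillates by less than e, the sets [U n], [V n] and some later
[V m], which lies in [W n.+1], all have points: a contradiction. *)
Lemma feebly_compact_sections_continuous (R : realType) (X Y : topologicalType)
    (f : X * Y -> R) (e : R) (y : Y) : feebly_compact (X * Y)%type ->
  continuous f -> 0 < e ->
  \forall y' \near y, forall x, `|f (x, y) - f (x, y')| <= e.
Proof.
move=> fXY fc e0; apply: contrapT => nnear.
(* The components of t are the next U n, V n and W n.+1, obtained from
   W = W n. *)
have step W : exists t : set X * set Y * set Y, open W -> W y ->
    [/\ open t.1.1, t.1.1 !=set0, open t.1.2, t.1.2 !=set0 & t.1.2 `<=` W] /\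
    [/\ open t.2, t.2 y, t.2 `<=` W & forall u v w,
      t.1.1 u -> t.1.2 v -> t.2 w -> e < `|f (u, w) - f (u, v)|].
  have [[oW Wy]|nW] := pselect (open W /\ W y); last first.
    by exists (setT, setT, setT) => oW Wy; exfalso; apply: nW.
  have [y' [Wy' [x exy]]] : exists y', W y' /\
      exists x, e < `|f (x, y) - f (x, y')|.
    apply: contrapT => h; apply: nnear.
    have : nbhs y W by exact: open_nbhs_nbhs.
    apply: filterS => y' Wy' x; rewrite leNgt; apply/negP => exy.
    by apply: h; exists y'; split => //; exists x.
  pose d := (`|f (x, y) - f (x, y')| - e) / 2.
  have d0 : 0 < d by rewrite /d; lra.
  have near_d z : nbhs z [set z' | `|f z - f z'| < d].
    by have /cvgrPdist_lt := fc z; apply.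
  have [[P Q] /= [xP yQ] PQd] := near_d (x, y).
  have [[P' Q'] /= [xP' yQ'] PQd'] := near_d (x, y').
  exists ((P `&` P')°, (W `&` Q')°, (W `&` Q)°) => _ _ /=; split; split.
  - exact: open_interior.
  - by exists x; exact: filterI.
  - exact: open_interior.
  - by exists y'; apply: filterI => //; exact: open_nbhs_nbhs.
  - by move=> v /interior_subset [].
  - exact: open_interior.
  - by apply: filterI => //; exact: open_nbhs_nbhs.
  - by move=> v /interior_subset [].
  move=> u v w /interior_subset[Pu P'u] /interior_subset[_ Q'v]
    /interior_subset[_ Qw].
  have h1 : `|f (x, y) - f (u, w)| < d by exact: (PQd (u, w)).
  have h2 : `|f (u, v) - f (x, y')| < d.
    by rewrite distrC; exact: (PQd' (u, v)).
  have h3 := ler_distD (f (u, w)) (f (x, y)) (f (x, y')).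
  have h4 := ler_distD (f (u, v)) (f (u, w)) (f (x, y')).
  by move: h1 h2 h3 h4; rewrite /d; lra.
have {step}/choice [g gP] := step.
pose W := fix W n := if n is k.+1 then (g (W k)).2 else setT.
have WP n : open (W n) /\ W n y.
  by elim: n => [|n [oW Wy]]; [split => //; exact: openT
    |have [_ []] := gP (W n) oW Wy].
have {}gP n := gP _ (WP n).1 (WP n).2.
have Wle m n : (m <= n)%N -> W n `<=` W m.
  elim: n => [|n IHn]; first by rewrite leqn0 => /eqP ->.
  rewrite leq_eqVlt => /predU1P[->//|/IHn]; apply: subset_trans.
  by have [_ []] := gP n.
have [||[x0 y0] xyP] := fXY (fun n => (g (W n)).1.1 `*` (g (W n)).1.2).
- move=> n; have [[op1 _ op2 _ _] _] := gP n; rewrite openE => -[u v] [/= gu gv].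
  exists ((g (W n)).1.1, (g (W n)).1.2) => //.
  by split; exact: open_nbhs_nbhs.
- move=> n; have [[_ [u ?] _ [v ?] _] _] := gP n; by exists (u, v).
have [[P Q] /= [xP yQ] PQe] : nbhs (x0, y0) [set z | `|f (x0, y0) - f z| < e / 2].
  by have /cvgrPdist_lt := fc (x0, y0); apply; lra.
have PQn : nbhs (x0, y0) (P `*` Q) by exists (P, Q).
have [n _ [[u v] [[/= Pu Qv] [/= gu gv]]]] := xyP _ PQn 0%N.
have [m nm [[u' v'] [[/= _ Qv'] [/= _ gv']]]] := xyP _ PQn n.+1.
have Wv' : (g (W n)).2 v'.
  by apply: (Wle n.+1 m nm); have [[_ _ _ _ gW] _] := gP m; exact: gW.
have [_ [_ _ _ /(_ u v v' gu gv Wv')]] := gP n.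
have h1 : `|f (x0, y0) - f (u, v)| < e / 2 by exact: (PQe (u, v)).
have h2 : `|f (u, v') - f (x0, y0)| < e / 2.
  by rewrite distrC; exact: (PQe (u, v')).
have := ler_distD (f (x0, y0)) (f (u, v')) (f (u, v)).
by lra.
Qed.

(** This is total boundedness of Y for the sup-distance between sections.
Otherwise there is an infinite e-separated sequence in Y; a cluster point of the
balls of radius e/4 around its members is within e/2 of two of them. *)
Lemma feebly_compact_sections_net (R : realType) (X Y : topologicalType)
    (f : X * Y -> R) (e : R) (y0 : Y) : feebly_compact (X * Y)%type ->
  feebly_compact Y -> continuous f -> 0 < e ->
  exists s : nat -> Y, forall y, exists n, forall x,
    `|f (x, y) - f (x, s n)| <= e.
Proof.
move=> fXY fY fc e0; apply: contrapT => nos.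
(* g extends any finite list by a point far from all its members. *)
have /choice [g gP] : forall l : seq Y, exists y,
    forall z, z \in l -> ~ forall x, `|f (x, y) - f (x, z)| <= e.
  move=> l; apply: contrapT => h; apply: nos; exists (nth y0 l) => y.
  apply: contrapT => hy; apply: h; exists y => z zl hz; apply: hy.
  by exists (index z l); rewrite nth_index.
pose L := fix L n := if n is k.+1 then g (L k) :: L k else [::].
pose s n := g (L n).
have sL m n : (m < n)%N -> s m \in L n.
  elim: n => // n IHn; rewrite ltnS leq_eqVlt /= inE => /predU1P[->|/IHn ->].
    by rewrite eqxx.
  by rewrite orbT.
pose near_s y := [set y' | forall x, `|f (x, y) - f (x, y')| <= e / 4%:R].
have near_sP y : nbhs y (near_s y).
  by apply: feebly_compact_sections_continuous => //; lra.
have [||y yP] := fY (fun n => (near_s (s n))°).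
- by move=> n; exact: open_interior.
- by move=> n; exists (s n); exact: near_sP.
have [n _ [v [yv /interior_subset sv]]] := yP _ (near_sP y) 0%N.
have [m nm [w [yw /interior_subset sw]]] := yP _ (near_sP y) n.+1.
apply: (gP (L m) (s n)); first exact: sL.
move=> x; rewrite -/(s m).
have := ler_distD (f (x, w)) (f (x, s m)) (f (x, s n)).
have := ler_distD (f (x, y)) (f (x, w)) (f (x, s n)).
have := ler_distD (f (x, v)) (f (x, y)) (f (x, s n)).
have := sw x; have := sv x; have := yw x; have := yv x.
rewrite (distrC (f (x, w)) (f (x, y))) (distrC (f (x, v)) (f (x, s n))).
by lra.
Qed.

(** The union over k of the (1/(k+1))-nets of Y is a countable set of points whose
values determine the whole section [f (x, _)]. *)
Lemma functionally_countable_sections (R : realType) (X Y : topologicalType)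
    (f : X * Y -> R) : feebly_compact (X * Y)%type -> feebly_compact Y ->
  functionally_countable R X -> continuous f ->
  exists code : X -> nat,
    forall x x', code x = code x' -> forall y, f (x, y) = f (x', y).
Proof.
move=> fXY fY fcX fc.
have [[y0]|noY] := pselect (inhabited Y); last first.
  by exists (fun=> 0%N) => x x' _ y; exfalso; apply: noY.
have /choice [s sP] : forall k : nat, exists s : nat -> Y, forall y, exists n,
    forall x, `|f (x, y) - f (x, s n)| <= k.+1%:R^-1.
  by move=> k; apply: feebly_compact_sections_net => //; rewrite invr_gt0.
pose F (i : nat * nat) x := f (x, s i.1 i.2).
have Fc i : continuous (F i).
  move=> x; apply: (@cvg_comp _ _ _ (fun x => (x, s i.1 i.2)) f _
    (nbhs (x, s i.1 i.2))); last exact: fc.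
  by apply: cvg_pair; [exact: cvg_id|exact: cvg_cst].
have [code codeP] := functionally_countable_family fcX Fc.
exists code => x x' /codeP Fxx' y; apply/eqP; rewrite -subr_eq0 -normr_le0.
apply/ler_addgt0Pr => e e0; rewrite add0r.
have [k ke] : exists k : nat, k.+1%:R^-1 < e / 2.
  exists (Num.trunc (e / 2)^-1); rewrite invf_plt ?posrE//; last by lra.
  exact: truncnS_gt.
have [n nP] := sP k y.
have := ler_distD (f (x, s k n)) (f (x, y)) (f (x', y)).
have := nP x; have := nP x'; have := Fxx' (k, n); rewrite /F /= => ->.
rewrite (distrC (f (x', s k n))); move: ke; move: (k.+1%:R^-1) => d; lra.
Qed.

Lemma countable_range_code (T U : Type) (C : countType) (f : T -> U)
    (code : T -> C) :
  (forall x x', code x = code x' -> f x = f x') -> countable (range f).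
Proof.
move=> codeP; pose fib c := [set r | exists2 x, code x = c & f x = r].
have -> : range f = \bigcup_(c in [set: C]) fib c.
  apply/seteqP; split => [_ [x _ <-]|_ [c _ [x _ <-]]]; last by exists x.
  by exists (code x) => //; exists x.
apply: bigcup_countable => // c _.
have [[r [x cx fx]]|fib0] := pselect (fib c !=set0); last first.
  suff -> : fib c = set0 by exact: countable0.
  by apply: contrapT => /eqP/set0P.
apply: (sub_countable _ (countable1 r)); apply: subset_card_le.
by move=> _ [x' cx' <-]; rewrite -fx; apply: codeP; rewrite cx.
Qed.

Lemma dfwith_continuous2 (I : finType) (X : I -> topologicalType) (i : I) :
  continuous (fun z : X i * prod_topology X => dfwith z.2 i z.1 : prod_topology X).
Proof.
apply: continuous_prod_topology => j.
have [ij|nij] := eqVneq i j.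
  case: _ / ij => z; under eq_fun do rewrite dfwithin.
  exact: cvg_fst.
move=> z; under eq_fun do rewrite dfwithout//.
apply: (@cvg_comp _ _ _ snd (@proj I X j) _ (nbhs z.2)); first exact: cvg_snd.
exact: proj_continuous.
Qed.

(** The code of the i-th coordinate comes from the sections of
[(x, p) |-> f (dfwith p i x)], so coordinates with equal codes can be exchanged
without changing f; finitely many exchanges lead from p to p'. *)
Lemma functionally_countable_prod (R : realType) (I : finType)
    (X : I -> topologicalType) : (forall i, seq_feebly_compact (X i)) ->
  (forall i, functionally_countable R (X i)) ->
  functionally_countable R (prod_topology X).
Proof.
move=> sX fcX f fc; have sP := seq_feebly_compact_prod sX.
have codeP i : {code : X i -> nat | forall x x', code x = code x' ->
    forall p : prod_topology X, f (dfwith p i x) = f (dfwith p i x')}.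
  apply: cid; apply: (@functionally_countable_sections R (X i) (prod_topology X)
    (fun z => f (dfwith z.2 i z.1))).
  - exact/seq_feebly_compactW/seq_feebly_compactX.
  - exact: seq_feebly_compactW.
  - exact: fcX.
  - move=> z; apply: (@cvg_comp _ _ _ _ f _ (nbhs (dfwith z.2 i z.1 : prod_topology X))).
      exact: dfwith_continuous2.
    exact: fc.
pose code p : {ffun I -> nat} := [ffun i => sval (codeP i) (p i)].
apply: (@countable_range_code _ _ _ f code) => p p' pp'.
pose mix (s : seq I) : prod_topology X := fun i => if i \in s then p' i else p i.
have mixP s : f (mix s) = f p.
  elim: s => [|i s IHs]; first by congr f; apply: functional_extensionality_dep.
  have dfE q (x : X i) : (forall j, j != i -> q j = mix s j) -> q i = x ->
      dfwith (mix s) i x = q.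
    move=> qs qi; apply: functional_extensionality_dep => j.
    by case: dfwithP => // k ik; rewrite qs// eq_sym.
  rewrite -IHs -(dfE (mix (i :: s)) (p' i)).
  - rewrite -[in RHS](dfE (mix s) (mix s i))//; apply: (svalP (codeP i)).
    rewrite /mix; case: ifP => // _.
    by have := congr1 (fun c : {ffun I -> nat} => c i) pp'; rewrite !ffunE.
  - by move=> j ji; rewrite /mix inE (negbTE ji).
  - by rewrite /mix inE eqxx.
rewrite -(mixP (enum I)); congr f; apply: functional_extensionality_dep => i.
by rewrite /mix mem_enum.
Qed.

Theorem corollary10 (R : realType) (n : nat) (X : 'I_n -> topologicalType)
    (n_ge1 : (1 <= n)%N)
    (pcX : forall i : 'I_n, pseudocompact R (X i))
    (fcX : forall i : 'I_n, functionally_countable R (X i)) :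
  pseudocompact R (prod_topology X) /\
  functionally_countable R (prod_topology X).
Proof.
have sX i : seq_feebly_compact (X i).
  apply: functionally_countable_seq_feebly_compact (fcX i).
    by have [[]] := pcX i.
  exact: pseudocompact_feebly_compact (pcX i).
split; last exact: functionally_countable_prod.
split; first by apply: (tychonoff_prod R) => i; have [] := pcX i.
move=> f; apply: feebly_compact_bounded.
exact/seq_feebly_compactW/seq_feebly_compact_prod.
Qed.
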